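(* Let $(X,d,\nu)$ be a metric measure space with $\nu(X)=+\infty$, and let $s>0$. Assume: (i) ($\nu$ is upper Ahlfors regular) there exists $C_A>0$ such that $\nu(B(x,r))\le C_A r^s$ for all $x\in X$ and $r>0$; (ii) $(X,d,\nu)$ admits an asymptotic volume ratio with the same exponent $s$, i.e. the limit $$\mathrm{AVR}=\lim_{r\to\infty}\frac{\nu(B(x_0,r))}{r^s}$$ exists and belongs to $(0,+\infty)$ for some (equivalently, all) $x_0\in X$ (its value does not depend on $x_0$); (iii) for every $x\in X$ the map $r\mapsto \nu(B(x,r))$ is continuous. Then for all $p\in[1,\infty)$ and all $u\in L^p(X,\nu)$, $$c_1\|u\|_{L^p(X,\nu)}^p\le \bigg[\frac{u(x)-u(y)}{d(x,y)^{\frac sp}}\bigg]^p_{L^p_w(X\times X,\nu\otimes\nu)}\le c_2\|u\|_{L^p(X,\nu)}^p ,$$ and moreover, setting $$E_\lambda=\bigg\{(x,y)\in X\times X:\ \frac{|u(x)-u(y)|}{d(x,y)^{\frac sp}}\ge\lambda\bigg\}\qquad(\lambda>0),$$ one has $$\lim_{\lambda\to0^+}\lambda^p(\nu\otimes\nu)(E_\lambda)=c_3\|u\|_{L^p(X,\nu)}^p ,$$ with constants $c_1=c_3=2\cdot\mathrm{AVR}$ and $c_2=2^{p+1}C_A$.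
   Context: A metric measure space is a triple $(X,d,\nu)$, where $(X,d)$ is a complete and separable metric space and $\nu$ is a nonzero non-negative Borel measure on $X$ that is finite on bounded sets. $B(x,r)=\{y\in X: d(x,y)<r\}$ is the ball with center $x$ and radius $r>0$. Functions $u$ are real-valued. For a measure space $(Z,\mu)$, $p\ge 1$ and a $\mu$-measurable function $g:Z\to\mathbb{R}$, the weak-$L^p$ (Marcinkiewicz) quantity, raised to the power $p$, is $$[g]^p_{L^p_w(Z,\mu)}=\sup_{\lambda>0}\lambda^p\,\mu(\{z\in Z:\ |g(z)|\ge\lambda\}).$$ Here it is used with $Z=X\times X$ and $\mu=\nu\otimes\nu$. Difference quotients are taken to be $0$ on the diagonal $\{x=y\}$. *)

(* Defs.v *)
From HB Require Import structures.
From mathcomp Require Import all_boot all_order all_algebra.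
From mathcomp Require Import all_classical all_reals all_analysis.

Set Implicit Arguments.
Unset Strict Implicit.
Unset Printing Implicit Defensive.

Import Order.TTheory GRing.Theory Num.Theory.
Import numFieldNormedType.Exports.

Local Open Scope classical_set_scope.
Local Open Scope ring_scope.

(* Complete metric spaces carrying a sigma-algebra; that the sigma-algebra is
   the Borel one is required in [metric_measure_space]. *)
#[short(type="measurableMetricType")]
HB.structure Definition MeasurableMetric d (R : realType) :=
  {T of Metric R T & Complete T & Measurable d T}.

Definition separable (T : topologicalType) : Prop :=
  exists2 D : set T, countable D & dense D.

Definition mdist_bounded (R : realType) (T : metricType R) (A : set T) : Prop :=
  exists M : R, forall x y, A x -> A y -> mdist x y <= M.

Record metric_measure_space (d : measure_display) (R : realType)
    (X : measurableMetricType d R) (nu : {measure set X -> \bar R}) : Prop := {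
  mms_separable : separable X ;
  mms_borel : @measurable d X = <<s [set A : set X | open A] >> ;
  mms_neq0 : nu [set: X] <> 0%E ;
  mms_bounded_lty : forall A : set X,
    measurable A -> mdist_bounded A -> (nu A < +oo)%E
}.

(* By [ballEmdist], [ball x r] is [set y | mdist x y < r]. *)
Definition upper_ahlfors (d : measure_display) (R : realType)
    (X : measurableMetricType d R) (nu : {measure set X -> \bar R})
    (s CA : R) : Prop :=
  forall (x : X) (r : R), 0 < r -> (nu (ball x r) <= (CA * r `^ s)%:E)%E.

Definition has_avr (d : measure_display) (R : realType)
    (X : measurableMetricType d R) (nu : {measure set X -> \bar R})
    (s AVR : R) : Prop :=
  0 < AVR /\ exists x0 : X,
    (fun r : R => nu (ball x0 r) * ((r `^ s)^-1)%:E)%E @ +oo --> AVR%:E.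

(* The p-th power of the weak-L^p quantity of g. *)
Definition weak_Lp_pow (d : measure_display) (R : realType)
    (Z : measurableType d) (mu : set Z -> \bar R) (p : R) (g : Z -> R)
    : \bar R :=
  ereal_sup [set ((lambda `^ p)%:E * mu [set z | (lambda <= `|g z|)%R])%E
            | lambda in [set l : R | 0 < l]].

Definition diff_quot (R : realType) (X : metricType R) (u : X -> R) (a : R)
    (z : X * X) : R :=
  if z.1 == z.2 then 0 else (u z.1 - u z.2) / mdist z.1 z.2 `^ a.

Definition Elevel (R : realType) (X : metricType R) (u : X -> R) (a : R)
    (lambda : R) : set (X * X) :=
  [set z | lambda <= `|diff_quot u a z|].

(* Main.v *)
(* Cut E_lambda along |u(y)| <= |u(x)|: up to swapping the coordinates, both
   pieces have the form E_lambda /\ G with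
   {|u(y)| < |u(x)|} <= G <= {|u(y)| <= |u(x)|}, so each contributes half of
   every constant.  The x-section of such a piece lies in the closed ball of
   radius (2|u(x)|/lambda)^(p/s) around x, so by Ahlfors regularity lambda^p
   times its measure is at most 2^p C_A |u(x)|^p.  As lambda -> 0+ that
   quantity tends to AVR |u(x)|^p, since |u| is small off a set of finite
   measure, so that the section is close to the ball of radius
   (|u(x)|/lambda)^(p/s).  Dominated convergence gives the limit; the lower
   weak-type bound follows because the supremum dominates the limit. *)
Require Import Defs.
From HB Require Import structures.
From mathcomp Require Import all_boot all_order all_algebra.
From mathcomp Require Import all_classical all_reals all_analysis.
From mathcomp Require Import measurable_realfun lra.

Set Implicit Arguments.
Unset Strict Implicit.
Unset Printing Implicit Defensive.

Import Order.TTheory GRing.Theory Num.Theory.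
Import numFieldNormedType.Exports.

Local Open Scope classical_set_scope.
Local Open Scope ring_scope.

(** * Measurability of the distance and of the level sets *)

Lemma countable_bigcup_measurable (d : measure_display) (T : sigmaRingType d)
    (I : Type) (D : set I) (F : I -> set T) :
  countable D -> (forall i, D i -> measurable (F i)) ->
  measurable (\bigcup_(i in D) F i).
Proof.
move=> cD mF; rewrite bigcup_set_type; apply: countable_bigcupT_measurable.
  have /countable_injP[f finj] := cD; apply/countable_injP.
  exists (f \o \val) => i j _ _ fij; apply: val_inj.
  by apply: finj fij; rewrite inE; exact: set_valP.
by move=> i; apply: mF; exact: set_valP.
Qed.

Section metric_measurability.
Context (d : measure_display) (R : realType) (X : measurableMetricType d R).
Implicit Types x y : X.

Lemma open_mball x (r : R) : open (ball x r).
Proof.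
rewrite openE => y; rewrite ballEmdist /= => xy.
apply/nbhs_ballP; exists (r - mdist x y); first by rewrite /= subr_gt0.
move=> z; rewrite !ballEmdist /= ltrBrDl.
exact/le_lt_trans/metric_triangle.
Qed.

Hypothesis borelX : @measurable d X = <<s [set A : set X | open A] >>.
Hypothesis sepX : separable X.

Lemma measurable_mball x (r : R) : measurable (ball x r).
Proof. by rewrite borelX; apply: sub_sigma_algebra; exact: open_mball. Qed.

Lemma measurable_fun_lt_rays (d' : measure_display) (T : measurableType d')
    (f : T -> R) : (forall r, measurable [set z | f z < r]) ->
  measurable_fun setT f.
Proof.
move=> mf _; apply: (measurability _ (RGenInftyO.measurableE R)) => //.
by move=> _ [_ [r ->] <-]; rewrite setTI preimage_itvNyo.
Qed.

Lemma measurable_mdist x : measurable_fun setT (mdist x).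
Proof.
apply: measurable_fun_lt_rays => r.
by have := measurable_mball x r; rewrite ballEmdist.
Qed.

(** The target is the product sigma-algebra. Separability reduces [mdist x y < r] to a countable
    union, over [q] in a dense set, of conditions on the sum of two one-variable distances. *)
Lemma measurable_mdist2 :
  measurable_fun [set: X * X] (fun z => mdist z.1 z.2).
Proof.
have [D cD dD] := sepX.
apply: measurable_fun_lt_rays => r.
rewrite (_ : [set _ | _] =
  \bigcup_(q in D) [set z : X * X | mdist q z.1 + mdist q z.2 < r]); last first.
  apply/seteqP; split => [[x y] /= xyr|[x y] [q _] /=]; last first.
    by rewrite (metric_sym q x); exact/le_lt_trans/metric_triangle.
  (* Half the slack suffices: the detour through [q] exceeds [mdist x y] by at most
     [2 * mdist x q]. *)
  pose e := (r - mdist x y) / 2.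
  have e0 : 0 < e by rewrite divr_gt0// subr_gt0.
  have [q [xq Dq]] : ball x e `&` D !=set0.
    by apply: dD; [exists x; exact: ballxx|exact: open_mball].
  exists q => //=; move: xq; rewrite ballEmdist /= => xq.
  have := metric_triangle q x y; rewrite (metric_sym q x) => qy.
  rewrite (le_lt_trans (lerD (lexx _) qy))// addrA -ltrBrDr.
  by rewrite (splitr (r - _)) ltrD.
apply: countable_bigcup_measurable => // q _.
rewrite [X in measurable X](_ : _ = (fun z : X * X => mdist q z.1 + mdist q z.2)
  @^-1` `]-oo, r[); last by rewrite preimage_itvNyo.
rewrite -[X in measurable X]setTI.
apply: measurable_funD => //.
  by apply: measurableT_comp => //; exact: measurable_mdist.
by apply: measurableT_comp => //; exact: measurable_mdist.
Qed.

End metric_measurability.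

(** On the diagonal the quotient is 0, below every positive level; elsewhere the denominator is
    positive and can be cleared. *)
Lemma ElevelP (R : realType) (X : metricType R) (u : X -> R) (a l : R)
    (x y : X) : 0 < l ->
  Elevel u a l (x, y) <-> x != y /\ l * mdist x y `^ a <= `|u x - u y|.
Proof.
move=> l0; rewrite /Elevel /diff_quot /=; case: eqVneq => [_|xy].
  by rewrite normr0 leNgt l0; split=> // -[].
have d0 : 0 < mdist x y `^ a by rewrite powR_gt0// mdist_gt0.
rewrite normrM normfV (ger0_norm (ltW d0)) ler_pdivlMr//.
by split=> // -[].
Qed.

Lemma measurable_Elevel (d : measure_display) (R : realType)
    (X : measurableMetricType d R) (u : X -> R) (a l : R) :
  @measurable d X = <<s [set A : set X | open A] >> -> separable X ->
  measurable_fun setT u -> 0 < l -> measurable (Elevel u a l).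
Proof.
move=> borelX sepX mu l0.
have md := measurable_mdist2 borelX sepX.
rewrite (_ : Elevel u a l = (setT `&` [set z | 0 < mdist z.1 z.2]) `&`
  (setT `&` [set z | l * mdist z.1 z.2 `^ a <= `|u z.1 - u z.2|])); last first.
  by rewrite !setTI; apply/seteqP; split => -[x y];
    rewrite ElevelP//= mdist_gt0.
apply: measurableI.
  rewrite setTI -preimage_itvoy -[X in measurable X]setTI.
  exact: md.
apply: measurable_fun_le => //.
  apply: measurable_funM => //.
  exact: (@measurableT_comp _ _ _ _ _ _ (@powR R ^~ a)).
apply: measurableT_comp => //; apply: measurable_funB; exact: measurableT_comp.
Qed.

(** * Powers of [c / l] as [l] tends to 0 from the right *)

Section powR_asymptotics.
Context (R : realType).
Implicit Types a b c l p s t D : R.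

(** Solves a level-set inequality for the distance [D]. The slack [t < c] yields the strict
    inequality that open balls require. *)
Lemma lt_powR_inv a l c t D : 0 < a -> 0 < l -> 0 <= D -> 0 <= t < c ->
  l * D `^ a <= t -> D < (c / l) `^ a^-1.
Proof.
move=> a0 l0 D0 /andP[t0 tc] lDt.
rewrite -[ltLHS]powRr1// -[X in D `^ X](mulfV (lt0r_neq0 a0)) powRrM.
rewrite gt0_ltr_powR ?invr_gt0// ?nnegrE ?powR_ge0//.
  by rewrite divr_ge0 ?ltW// (le_lt_trans t0).
by rewrite ltr_pdivlMr// mulrC (le_lt_trans lDt).
Qed.

Lemma cvg_powR_div_pinfty b c : 0 < b -> 0 < c ->
  (c / l) `^ b @[l --> 0^'+] --> +oo.
Proof.
move=> b0 c0; apply/cvgryPge => M.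
pose K := Num.max M 1; have K0 : 0 < K by rewrite lt_max ltr01 orbT.
near=> l; have l0 : 0 < l by near: l; exact: nbhs_right_gt.
apply: (@le_trans _ _ K); first by rewrite le_max lexx.
rewrite -[leLHS]powRr1 ?(ltW K0)// -[X in K `^ X](mulVf (lt0r_neq0 b0)) powRrM.
rewrite ge0_ler_powR ?nnegrE ?powR_ge0 ?(ltW b0) ?divr_ge0 ?(ltW c0)
  ?(ltW l0)//.
rewrite ler_pdivlMr// mulrC -ler_pdivlMr ?powR_gt0// ltW//.
by near: l; apply: nbhs_right_lt; rewrite divr_gt0// powR_gt0.
Unshelve. all: by end_near. Qed.

Lemma near_powR_div_gap b t c D : 0 < b -> 0 <= t < c ->
  \forall l \near 0^'+, (t / l) `^ b + D <= (c / l) `^ b.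
Proof.
move=> b0 /andP[t0 tc]; have c0 := le_lt_trans t0 tc.
have k0 : 0 < c `^ b - t `^ b.
  by rewrite subr_gt0 gt0_ltr_powR// nnegrE// ltW.
have /cvgryPge/(_ (D / (c `^ b - t `^ b))) := cvg_powR_div_pinfty b0 ltr01.
apply: filterS2 (nbhs_right_gt 0) => l l0.
rewrite div1r ler_pdivrMr// mulrBr => H.
by rewrite !powRM ?invr_ge0 ?(ltW l0) ?(ltW c0)//; lra.
Qed.

End powR_asymptotics.

Section scaled_balls.
Context (d : measure_display) (R : realType) (X : measurableMetricType d R)
  (nu : {measure set X -> \bar R}) (s p : R).
Hypotheses (s0 : 0 < s) (p0 : 0 < p).

Let powR_radius (c l : R) : 0 <= c -> 0 < l ->
  ((c / l) `^ (p / s)) `^ s = c `^ p / l `^ p.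
Proof.
move=> c0 l0; rewrite -powRrM divfK ?gt_eqF// powRM ?invr_ge0 ?(ltW l0)//.
by rewrite -[l^-1]powR_inv1 ?(ltW l0)// -powRrM mulN1r powRN.
Qed.

Lemma scaled_ball_le (CA c l : R) (x : X) : upper_ahlfors nu s CA ->
  0 < c -> 0 < l ->
  ((l `^ p)%:E * nu (ball x ((c / l) `^ (p / s))) <= (CA * c `^ p)%:E)%E.
Proof.
move=> ahl c0 l0; have lp0 : 0 < l `^ p by rewrite powR_gt0.
have r0 : 0 < (c / l) `^ (p / s) by rewrite powR_gt0// divr_gt0.
apply: (@le_trans _ _ ((l `^ p)%:E * (CA * ((c / l) `^ (p / s)) `^ s)%:E)%E).
  by rewrite lee_pmul2l// ahl.
by rewrite -EFinM lee_fin powR_radius ?(ltW c0)// mulrC -mulrA divfK ?gt_eqF.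
Qed.

(** This is the volume ratio composed with the diverging radius [r = (c / l)]^ (p / s)[, for which]l
    [^ p] equals [c]^ p / r [^ s]. *)
Lemma cvg_scaled_ball (A c : R) (x0 : X) : 0 < c ->
  (nu (ball x0 r) * ((r `^ s)^-1)%:E)%E @[r --> +oo] --> A%:E ->
  ((l `^ p)%:E * nu (ball x0 ((c / l) `^ (p / s))))%E @[l --> 0^'+]
    --> (A * c `^ p)%:E.
Proof.
move=> c0 avr.
have ps0 : 0 < p / s by rewrite divr_gt0.
have := cvg_comp _ _ (cvg_powR_div_pinfty ps0 c0) avr.
move=> /(cvgeZl (erefl : (c `^ p)%:E \is a fin_num)).
rewrite -EFinM [c `^ p * A]mulrC => H.
apply: cvg_trans H; apply: near_eq_cvg.
near=> l; have l0 : 0 < l by near: l; exact: nbhs_right_gt.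
rewrite /= powR_radius ?(ltW c0)// invf_div muleCA -EFinM.
rewrite mulrCA divff ?mulr1 1?muleC//.
by rewrite gt_eqF// powR_gt0.
Unshelve. all: by end_near. Qed.

End scaled_balls.

(** * Approximation of powers and two-sided limits *)

Lemma le_powR_limit (R : realType) (K p t m : R) : 0 < K -> 0 < p -> 0 <= t ->
  (forall c, t < c -> m <= K * c `^ p) -> m <= K * t `^ p.
Proof.
move=> K0 p0 t0 mle; rewrite -ler_pdivrMl//.
have [m0|m0] := leP (K^-1 * m) 0; first by rewrite (le_trans m0)// powR_ge0.
rewrite -[leLHS]powRr1 ?(ltW m0)//.
rewrite -[X in _ `^ X <= _](mulVf (lt0r_neq0 p0)) powRrM.
rewrite ge0_ler_powR ?nnegrE ?powR_ge0 ?(ltW p0)//.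
(* After taking [p]-th roots the bound is linear, and it is tested at [c = t + e]. *)
apply/ler_addgt0Pr => e e0.
rewrite -[leRHS]powRr1 ?addr_ge0 ?(ltW e0)//.
rewrite -[X in _ <= _ `^ X](mulfV (lt0r_neq0 p0)) powRrM.
rewrite ge0_ler_powR ?nnegrE ?powR_ge0 ?invr_ge0 ?(ltW p0) ?(ltW m0)//.
by rewrite ler_pdivrMl// mle// ltrDl.
Qed.

(** An epsilon form of convergence to a finite value for functions that may be infinite: the bounds
    themselves force [f] to be eventually finite. *)
Lemma cvge_bounds (R : realType) (T : Type) (F : set_system T) {FF : Filter F}
    (f : T -> \bar R) (x : R) :
  f @ F --> x%:E <->
  forall e : R, 0 < e -> \forall l \near F, ((x - e)%:E <= f l <= (x + e)%:E)%E.
Proof.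
split=> [/fine_cvgP[ffin fx] e e0|fx].
  have /cvgrPdist_le/(_ e e0) := fx.
  apply: filterS2 ffin => l fl; rewrite /= -[in X in _ -> X](fineK fl) !lee_fin.
  by rewrite ler_distlC.
have ffin : \forall l \near F, f l \is a fin_num.
  apply: filterS (fx 1 ltr01) => l /andP[xl lx].
  by rewrite fin_numElt (lt_le_trans _ xl) ?ltNyr// (le_lt_trans lx)// ltry.
apply/fine_cvgP; split => //; apply/cvgrPdist_le => e e0.
apply: filterS2 ffin (fx e e0) => l fl.
by rewrite -[in X in X -> _](fineK fl) !lee_fin ler_distlC.
Qed.

Lemma powR_approx_above (R : realType) (A t p e : R) :
  0 < A -> 0 < p -> 0 <= t -> 0 < e ->
  exists2 c, t < c & A * c `^ p <= A * t `^ p + e.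
Proof.
move=> A0 p0 t0 e0.
have tp0 := powR_ge0 t p.
have y0 : 0 <= t `^ p + e / A by rewrite addr_ge0// divr_ge0// ltW.
have cp : ((t `^ p + e / A) `^ p^-1) `^ p = t `^ p + e / A.
  by rewrite -powRrM mulVf ?gt_eqF// powRr1.
(* This [c] solves [A * c]^ p = A * t [^ p + e] exactly. *)
exists ((t `^ p + e / A) `^ p^-1); last first.
  by rewrite cp mulrDr mulrCA divff ?gt_eqF// mulr1.
rewrite ltNge; apply/negP => ct.
have : t `^ p + e / A <= t `^ p.
  by rewrite -cp; apply: ge0_ler_powR => //; rewrite ?ltW// nnegrE// powR_ge0.
by rewrite leNgt ltrDl divr_gt0.
Qed.

Lemma powR_approx_below (R : realType) (A t p e : R) :
  0 < A -> 0 < p -> 0 < t -> 0 < e ->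
  exists2 c, 0 < c < t & A * t `^ p - e <= A * c `^ p.
Proof.
move=> A0 p0 t0 e0.
have tp0 : 0 < t `^ p by rewrite powR_gt0.
pose y := Num.max (t `^ p - e / A) (t `^ p / 2).
have y0 : 0 < y by rewrite lt_max divr_gt0// orbT.
have yt : y < t `^ p.
  rewrite gt_max ltrBlDr ltrDl divr_gt0//=.
  by rewrite ltr_pdivrMr// mulr_natr mulr2n ltrDl.
have cp : (y `^ p^-1) `^ p = y.
  by rewrite -powRrM mulVf ?gt_eqF// powRr1// ltW.
exists (y `^ p^-1).
  rewrite powR_gt0//= ltNge; apply/negP => tc.
  have : t `^ p <= y.
    by rewrite -cp; apply: ge0_ler_powR => //; rewrite ?nnegrE ?powR_ge0// ltW.
  by rewrite leNgt yt.
rewrite cp -ler_pdivrMl// mulrBr mulrA mulVf ?gt_eqF// mul1r mulrC.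
by rewrite le_max lexx.
Qed.

(** * Sections of one half of the level set *)

Section level_sections.
Context (d : measure_display) (R : realType) (X : measurableMetricType d R)
  (nu : {sigma_finite_measure set X -> \bar R}) (s p CA A : R) (u : X -> R)
  (G : set (X * X)).
Hypotheses (borelX : @measurable d X = <<s [set A : set X | open A] >>)
  (sepX : separable X).
Hypotheses (s0 : 0 < s) (p0 : 0 < p) (CA0 : 0 < CA) (A0 : 0 < A).
Hypothesis ahl : upper_ahlfors nu s CA.
Hypothesis avr : exists x0 : X,
  (nu (ball x0 r) * ((r `^ s)^-1)%:E)%E @[r --> +oo] --> A%:E.
Hypothesis mu : measurable_fun setT u.
Hypothesis intu : (\int[nu]_x (`|u x| `^ p)%:E < +oo)%E.
Hypothesis mG : measurable G.
Hypothesis G_lt : forall x y, `|u y| < `|u x| -> G (x, y).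
Hypothesis G_le : forall x y, G (x, y) -> `|u y| <= `|u x|.

Let E l := Elevel u (s / p) l `&` G.

Let mE (l : R) : 0 < l -> measurable (E l).
Proof. by move=> l0; apply: measurableI => //; exact: measurable_Elevel. Qed.

Let sp0 : 0 < s / p. Proof. by rewrite divr_gt0. Qed.

(** Here [G] forces [u y = 0] too, so the difference vanishes. This case is separate because the
    lower squeeze needs some [c] with [0 < c < |u x|]. *)
Let section_u0 (l : R) x : 0 < l -> u x = 0 -> xsection (E l) x = set0.
Proof.
move=> l0 ux0; rewrite -subset0 => y; rewrite /xsection /= inE => -[+ /G_le].
move=> /(ElevelP _ _ _ _ l0)[xy]; rewrite ux0 normr0 normr_le0 => + /eqP uy0.
by rewrite uy0 subrr normr0 leNgt mulr_gt0// powR_gt0// mdist_gt0.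
Qed.

Let section_sub_ball (l c : R) x : 0 < l -> 2 * `|u x| < c ->
  xsection (E l) x `<=` ball x ((c / l) `^ (p / s)).
Proof.
move=> l0 ucl y; rewrite /xsection /= inE => -[].
move=> /(ElevelP _ _ _ _ l0)[xy lxy] /G_le uyx.
rewrite ballEmdist /= -[p / s]invf_div.
apply: (@lt_powR_inv _ _ _ _ (2 * `|u x|)); rewrite ?mdist_ge0 ?mulr_ge0//.
rewrite (le_trans lxy)// (le_trans (ler_normB _ _))// mulr2n mulrDl !mul1r.
by rewrite lerD2l.
Qed.

Lemma section_bound (l : R) x : 0 < l ->
  ((l `^ p)%:E * nu (xsection (E l) x) <= (CA * (2 * `|u x|) `^ p)%:E)%E.
Proof.
move=> l0; have msec := measurable_xsection x (mE l0).
have le_c c : 2 * `|u x| < c ->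
    ((l `^ p)%:E * nu (xsection (E l) x) <= (CA * c `^ p)%:E)%E.
  move=> uc; have c0 : 0 < c by rewrite (le_lt_trans _ uc)// mulr_ge0.
  apply: (le_trans _ (scaled_ball_le p s0 x ahl c0 l0)).
  rewrite lee_pmul2l ?lte_fin ?powR_gt0//.
  apply: le_measure; rewrite ?inE//; first exact: measurable_mball.
  exact: section_sub_ball.
have lnu0 : (0 <= (l `^ p)%:E * nu (xsection (E l) x))%E.
  by rewrite mule_ge0// lee_fin powR_ge0.
(* Any single admissible [c] gives finiteness, so that the infimum over [c] can be taken among real
   numbers. *)
have finl : ((l `^ p)%:E * nu (xsection (E l) x))%E \is a fin_num.
  rewrite ge0_fin_numE//; apply: le_lt_trans (le_c (2 * `|u x| + 1) _) _.
    by rewrite ltrDl.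
  exact: ltry.
rewrite -(fineK finl) lee_fin; apply: le_powR_limit => // c uc.
by rewrite -lee_fin fineK// le_c.
Qed.

Let K (e : R) := [set y | e <= `|u y|].

Let mK e : measurable (K e).
Proof.
rewrite -[X in measurable X]setTI; apply: measurable_fun_le => //.
exact: measurableT_comp.
Qed.

Let mup : measurable_fun setT (fun x => (`|u x| `^ p)%:E).
Proof.
apply/measurable_EFinP.
apply: (@measurableT_comp _ _ _ _ _ _ (@powR R ^~ p)) => //.
exact: measurableT_comp.
Qed.

(** Chebyshev's inequality: [e]^ p * nu (K e)[is at most the integral of]|u| [^ p]. *)
Let superlevel_lty (e : R) : 0 < e -> (nu (K e) < +oo)%E.
Proof.
move=> e0.
have ep0 : 0 < e `^ p by rewrite powR_gt0.
suff : ((e `^ p)%:E * nu (K e) < +oo)%E.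
  by apply: contraTT; rewrite -!leNgt !leye_eq => /eqP ->; rewrite gt0_muley.
apply: le_lt_trans intu; rewrite -integral_cst//.
apply: (@le_trans _ _ (\int[nu]_(x in K e) (`|u x| `^ p)%:E)%E).
  apply: ge0_le_integral => //.
  - by move=> x _; rewrite lee_fin ltW.
  - by apply: measurable_funTS.
  - move=> x /= ex; rewrite lee_fin; apply: ge0_ler_powR => //.
    + exact: ltW.
    + by rewrite nnegrE ltW.
exact: ge0_subset_integral.
Qed.

(* Off the finite-measure set of the [y] where [`|u y|] is at least a fixed
   [e > 0], [`|u x - u y|] is within [e] of [`|u x|], so the section at [x] is
   squeezed between two balls; the exceptional set is killed by [l `^ p]. The
   balls are recentred at the [x0] of the volume ratio: the shift
   [mdist x0 x] is negligible as the radii tend to infinity. *)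
Lemma section_limit x :
  ((l `^ p)%:E * nu (xsection (E l) x))%E @[l --> 0^'+]
    --> (A * `|u x| `^ p)%:E.
Proof.
have [ux0|ux0] := eqVneq (u x) 0.
  rewrite ux0 normr0 powR0 ?gt_eqF// mulr0.
  have cvg0 : cst (0 : \bar R)%E l @[l --> (0 : R)^'+] --> 0%:E.
    exact: cvg_cst.
  apply: cvg_trans cvg0; apply: near_eq_cvg.
  near=> l; have l0 : 0 < l by near: l; exact: nbhs_right_gt.
  by rewrite /= section_u0// measure0 mule0.
have t0 : 0 < `|u x| by rewrite normr_gt0.
set t := `|u x| in t0 *.
have [x0 avr0] := avr.
have bs : p / s = (s / p)^-1 by rewrite invf_div.
have b0 : 0 < p / s by rewrite divr_gt0.
pose phi c l := ((l `^ p)%:E * nu (ball x0 ((c / l) `^ (p / s))))%E.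
pose g (l : R) := ((l `^ p)%:E * nu (xsection (E l) x))%E.
have K_cvg0 e : 0 < e -> ((l `^ p)%:E * nu (K e))%E @[l --> 0^'+] --> 0%:E.
  move=> e0; have Kfin : nu (K e) \is a fin_num.
    by rewrite ge0_fin_numE//; exact: superlevel_lty.
  rewrite -[X in _ --> X](mul0e (nu (K e))); apply: cvgeZr => //.
  apply: cvg_EFin; first by near=> l.
  exact: powR_cvg0.
have upper c : t < c -> \forall l \near 0^'+,
    (g l <= phi c l + (l `^ p)%:E * nu (K ((c - t) / 2)%R))%E.
  move=> tc; pose e := (c - t) / 2.
  have e0 : 0 < e by rewrite divr_gt0// subr_gt0.
  (* With [c = t + 2e], the value [c'] lies strictly between [t + e] and [c]: the first gap makes
     the ball inclusion strict, the second pays for recentring. *)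
  pose c' := t + e * 3 / 2.
  have := @near_powR_div_gap _ (p / s) c' c (mdist x0 x) b0.
  have -> : 0 <= c' < c by rewrite /c' /e; apply/andP; split; lra.
  move=> /(_ isT); apply: filterS2 (nbhs_right_gt 0) => l l0 gap.
  have lp0 : (0 <= (l `^ p)%:E)%E by rewrite lee_fin powR_ge0.
  rewrite /g /phi -ge0_muleDr//; apply: lee_pmul => //.
  apply: (@le_trans _ _ (nu (ball x0 ((c / l) `^ (p / s)) `|` K e))); last first.
    by apply: measureU2 => //; exact: measurable_mball.
  apply: le_measure; rewrite ?inE.
  - exact: measurable_xsection (mE l0).
  - by apply: measurableU => //; exact: measurable_mball.
  move=> y; rewrite /xsection /= inE => -[/(ElevelP _ _ _ _ l0)[xy lxy] _].
  have [ey|ye] := leP e `|u y|; [by right|left].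
  rewrite ballEmdist /=; apply: lt_le_trans gap.
  rewrite (le_lt_trans (metric_triangle x0 x y))// addrC ltrD2r bs.
  apply: (@lt_powR_inv _ _ _ _ (t + e)); rewrite ?mdist_ge0//.
    by rewrite /c'; apply/andP; split; lra.
  by rewrite (le_trans lxy)// (le_trans (ler_normB _ _))// lerD2l ltW.
have lower c : 0 < c < t -> \forall l \near 0^'+,
    (phi c l <= g l + (l `^ p)%:E * nu (K ((t - c) / 2)%R))%E.
  (* Now [t = c + 2e]: off [K e] the difference is at least [t - e = c + e], and the gap from [c] to
     [c + e] pays for recentring. *)
  move=> /andP[c0 ct]; pose e := (t - c) / 2.
  have e0 : 0 < e by rewrite divr_gt0// subr_gt0.
  have := @near_powR_div_gap _ (p / s) c (c + e) (mdist x0 x) b0.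
  have -> : 0 <= c < c + e by apply/andP; split; lra.
  move=> /(_ isT); apply: filterS2 (nbhs_right_gt 0) => l l0 gap.
  have lp0 : (0 <= (l `^ p)%:E)%E by rewrite lee_fin powR_ge0.
  rewrite /g /phi -ge0_muleDr//; apply: lee_pmul => //.
  apply: (@le_trans _ _ (nu (xsection (E l) x `|` K e))); last first.
    by apply: measureU2 => //; exact: measurable_xsection (mE l0).
  apply: le_measure; rewrite ?inE.
  - exact: measurable_mball.
  - by apply: measurableU => //; exact: measurable_xsection (mE l0).
  move=> y; rewrite ballEmdist /= => x0y.
  have [ey|ye] := leP e `|u y|; [by right|left].
  rewrite /xsection /= inE.
  (* Strictness puts the pair in [G] through [G_lt] and also excludes [y = x]. *)
  have uyx : `|u y| < `|u x| by rewrite -/t (lt_trans ye)// /e; lra.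
  split; last exact: G_lt.
  apply/(ElevelP _ _ _ _ l0); split.
    by apply: contraTneq uyx => ->; rewrite ltxx.
  have xy : mdist x y < ((c + e) / l) `^ (p / s).
    apply: lt_le_trans gap; rewrite (le_lt_trans (metric_triangle x x0 y))//.
    by rewrite (metric_sym x) addrC ltrD2r.
  apply: (@le_trans _ _ (c + e)); last first.
    by rewrite (le_trans _ (lerB_dist _ _))// -/t; rewrite /e in ye *; lra.
  rewrite -ler_pdivlMl// [l^-1 * _]mulrC.
  have cel : 0 <= (c + e) / l by rewrite divr_ge0 ?addr_ge0 ?ltW.
  rewrite -[leRHS]powRr1// -[X in _ <= _ `^ X](mulVf (lt0r_neq0 sp0)).
  rewrite [leRHS]powRrM -bs.
  apply: ge0_ler_powR; rewrite ?nnegrE ?mdist_ge0 ?powR_ge0//; exact: ltW.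
have phi_cvg c : 0 < c -> phi c l @[l --> 0^'+] --> (A * c `^ p)%:E.
  by move=> c0; exact: cvg_scaled_ball.
apply/cvge_bounds => e e0.
(* Error budget: [e / 2] for replacing [t] by [c1] or [c2], [e / 4] for the ball volume and [e / 4]
   for the exceptional set. *)
have e20 : 0 < e / 2 by rewrite divr_gt0.
have e40 : 0 < e / 4 by rewrite divr_gt0.
have [c1 tc1 Ac1] := powR_approx_above A0 p0 (ltW t0) e20.
have [c2 c2t Ac2] := powR_approx_below A0 p0 t0 e20.
have c20 : 0 < c2 by case/andP: c2t.
have /cvge_bounds/(_ _ e40) phi1 := phi_cvg _ (lt_trans t0 tc1).
have /cvge_bounds/(_ _ e40) phi2 := phi_cvg _ c20.
have /cvge_bounds/(_ _ e40) K1 :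
    ((l `^ p)%:E * nu (K ((c1 - t) / 2)%R))%E @[l --> 0^'+] --> 0%:E.
  by apply: K_cvg0; rewrite divr_gt0// subr_gt0.
have /cvge_bounds/(_ _ e40) K2 :
    ((l `^ p)%:E * nu (K ((t - c2) / 2)%R))%E @[l --> 0^'+] --> 0%:E.
  by apply: K_cvg0; rewrite divr_gt0// subr_gt0; case/andP: c2t.
near=> l; apply/andP; split.
  have low : (phi c2 l <= g l + (l `^ p)%:E * nu (K ((t - c2) / 2)%R))%E.
    by near: l; exact: lower.
  have /andP[phi2l _] :
      ((A * c2 `^ p - e / 4)%:E <= phi c2 l <= (A * c2 `^ p + e / 4)%:E)%E.
    by near: l.
  have /andP[_ K2l] :
      ((0 - e / 4)%:E <= (l `^ p)%:E * nu (K ((t - c2) / 2)%R)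
        <= (0 + e / 4)%:E)%E.
    by near: l.
  have := le_trans (le_trans phi2l low) (leeD2l _ K2l).
  rewrite -leeBlDr// -EFinB; apply: le_trans; rewrite lee_fin; lra.
have up : (g l <= phi c1 l + (l `^ p)%:E * nu (K ((c1 - t) / 2)%R))%E.
  by near: l; exact: upper.
have /andP[_ phi1l] :
      ((A * c1 `^ p - e / 4)%:E <= phi c1 l <= (A * c1 `^ p + e / 4)%:E)%E.
  by near: l.
have /andP[_ K1l] :
      ((0 - e / 4)%:E <= (l `^ p)%:E * nu (K ((c1 - t) / 2)%R)
        <= (0 + e / 4)%:E)%E.
  by near: l.
apply: (le_trans up); apply: (le_trans (leeD phi1l K1l)).
rewrite -EFinD lee_fin; lra.
Unshelve. all: by end_near. Qed.

(** * Integration of the section estimates *)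

Let I := (\int[nu]_x (`|u x| `^ p)%:E)%E.

Let msection (l : R) : 0 < l ->
  measurable_fun setT (fun x => (l `^ p)%:E * nu (xsection (E l) x))%E.
Proof.
by move=> l0; apply: measurable_funeM;
  exact: (measurable_fun_xsection nu (mE l0)).
Qed.

(** The product measure is by definition the integral of the section measures; only the scalar has
    to be moved inside. *)
Let scaled_product (l : R) : 0 < l ->
  ((l `^ p)%:E * (nu \x nu) (E l) =
   \int[nu]_x ((l `^ p)%:E * nu (xsection (E l) x)))%E.
Proof.
move=> l0; rewrite ge0_integralZl//; last by rewrite lee_fin powR_ge0.
exact: (measurable_fun_xsection nu (mE l0)).
Qed.

Let bound_E x : (CA * (2 * `|u x|) `^ p)%:E =
  ((2 `^ p * CA)%:E * (`|u x| `^ p)%:E)%E.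
Proof. by rewrite -EFinM powRM// mulrCA mulrA. Qed.

Let mbound : measurable_fun setT (fun x => (CA * (2 * `|u x|) `^ p)%:E).
Proof.
apply: (eq_measurable_fun (fun x => ((2 `^ p * CA)%:E * (`|u x| `^ p)%:E)%E)).
  by move=> x _; rewrite bound_E.
exact: measurable_funeM.
Qed.

Let int_bound :
  (\int[nu]_x (CA * (2 * `|u x|) `^ p)%:E = (2 `^ p * CA)%:E * I)%E.
Proof.
under eq_integral do rewrite bound_E.
by rewrite ge0_integralZl// lee_fin mulr_ge0 ?powR_ge0// ltW.
Qed.

Lemma product_level_bound (l : R) : 0 < l ->
  ((l `^ p)%:E * (nu \x nu) (E l) <= (2 `^ p * CA)%:E * I)%E.
Proof.
move=> l0; rewrite scaled_product// -int_bound; apply: ge0_le_integral => //.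
- by move=> x _; rewrite mule_ge0// lee_fin powR_ge0.
- exact: msection.
- by move=> x _; exact: section_bound.
Qed.

Lemma product_level_limit :
  ((l `^ p)%:E * (nu \x nu) (E l))%E @[l --> 0^'+] --> (A%:E * I)%E.
Proof.
have Ifin : I \is a fin_num.
  rewrite ge0_fin_numE//; apply: integral_ge0 => x _.
  by rewrite lee_fin powR_ge0.
(* Dominated convergence concerns sequences, so the right limit is tested along positive sequences
   tending to 0; the dominating function is independent of [l]. *)
rewrite -(fineK Ifin) -EFinM; apply/cvge_at_rightP => l_ [l0 lcvg].
rewrite EFinM fineK//.
have -> : (A%:E * I = \int[nu]_x (A * `|u x| `^ p)%:E)%E.
  under eq_integral do rewrite EFinM.
  by rewrite ge0_integralZl// lee_fin ltW.
under eq_cvg do rewrite scaled_product//.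
have [|||||_ _] := @dominated_convergence _ X R nu setT measurableT
  (fun n x => (l_ n `^ p)%:E * nu (xsection (E (l_ n)) x))%E
  (fun x => (A * `|u x| `^ p)%:E) (fun x => (CA * (2 * `|u x|) `^ p)%:E).
- by move=> n; exact: msection.
- apply/measurable_EFinP; apply: measurable_funM => //.
  exact/measurable_EFinP.
- apply: aeW => x _; have /cvge_at_rightP := @section_limit x.
  by apply; split.
- apply/integrableP; split => //.
  under eq_integral do
    rewrite gee0_abs ?lee_fin ?mulr_ge0 ?powR_ge0 ?(ltW CA0)//.
  by rewrite int_bound -(fineK Ifin) -EFinM ltry.
- apply: aeW => x n _; rewrite gee0_abs; first exact: section_bound.
  by rewrite mule_ge0// lee_fin powR_ge0.
- exact.
Qed.

End level_sections.

(** * Symmetry of the product measure and sigma-finiteness *)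

Lemma product_measure_swap (d : measure_display) (T : measurableType d)
    (R : realType) (m : {sigma_finite_measure set T -> \bar R})
    (S : set (T * T)) : measurable S ->
  ((m \x m) ((fun z => (z.2, z.1)) @^-1` S) = (m \x m) S)%E.
Proof.
(* Tonelli for the indicator of [S] equates integration over x-sections and y-sections; the
   y-sections of [S] are the x-sections of its swap. *)
move=> mS; have := indic_fubini_tonelli m m mS.
rewrite indic_fubini_tonelli_FE //.
have -> := indic_fubini_tonelli_GE m mS => E.
by rewrite [RHS]E.
Qed.

(** Balls of radius [n + 1] about one point exhaust the space and have finite measure. Tonelli and
    the measurability of section measures rest on this. *)
Lemma sigma_finite_bounded_balls (d : measure_display) (R : realType)
    (X : measurableMetricType d R) (nu : {measure set X -> \bar R}) (s CA : R) :
  @measurable d X = <<s [set A : set X | open A] >> ->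
  X -> upper_ahlfors nu s CA -> sigma_finite setT nu.
Proof.
move=> borelX x ahl; exists (fun n => ball x n.+1%:R).
  apply/esym; rewrite -subTset => y _.
  exists (Num.bound (mdist x y)) => //; rewrite ballEmdist /=.
  by rewrite (lt_le_trans (archi_boundP (mdist_ge0 x y)))// ler_nat.
move=> n; split; first exact: measurable_mball.
by apply: le_lt_trans (ahl x _ (ltr0Sn _ _)) _; exact: ltry.
Qed.

(** * Assembling the two halves of the level set *)

Section weak_type.
Context (d : measure_display) (R : realType) (X : measurableMetricType d R)
  (nu : {sigma_finite_measure set X -> \bar R}) (s p CA A : R) (u : X -> R).
Hypotheses (borelX : @measurable d X = <<s [set A : set X | open A] >>)
  (sepX : separable X).
Hypotheses (s0 : 0 < s) (p0 : 0 < p) (CA0 : 0 < CA) (A0 : 0 < A).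
Hypothesis ahl : upper_ahlfors nu s CA.
Hypothesis avr : exists x0 : X,
  (nu (ball x0 r) * ((r `^ s)^-1)%:E)%E @[r --> +oo] --> A%:E.
Hypothesis mu : measurable_fun setT u.
Let I := (\int[nu]_x (`|u x| `^ p)%:E)%E.
Hypothesis intu : (I < +oo)%E.

Let Gle := [set z : X * X | `|u z.2| <= `|u z.1|].
Let Glt := [set z : X * X | `|u z.2| < `|u z.1|].

Let mu1 : measurable_fun setT (fun z : X * X => `|u z.1|).
Proof. by apply: measurableT_comp => //; exact: measurableT_comp. Qed.

Let mu2 : measurable_fun setT (fun z : X * X => `|u z.2|).
Proof. by apply: measurableT_comp => //; exact: measurableT_comp. Qed.

Let mGle : measurable Gle.
Proof. by rewrite -[Gle]setTI; exact: measurable_fun_le. Qed.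

Let mGlt : measurable Glt.
Proof.
rewrite (_ : Glt = ~` [set z | `|u z.1| <= `|u z.2|]).
  apply: measurableC; rewrite -[X in measurable X]setTI.
  exact: measurable_fun_le.
by apply/seteqP; split => z /=; rewrite /Glt /= ltNge => /negP.
Qed.

(** The level set is symmetric, so swapping coordinates carries its part in [Glt] onto its part
    outside [Gle], with the same measure. *)
Let Elevel_split (l : R) : 0 < l ->
  ((nu \x nu) (Elevel u (s / p) l) =
   (nu \x nu) (Elevel u (s / p) l `&` Gle) +
   (nu \x nu) (Elevel u (s / p) l `&` Glt))%E.
Proof.
move=> l0.
have mE : measurable (Elevel u (s / p) l) by exact: measurable_Elevel.
rewrite -(product_measure_swap nu (measurableI _ _ mE mGlt)).
have swapE : (fun z => (z.2, z.1)) @^-1` (Elevel u (s / p) l `&` Glt) =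
    Elevel u (s / p) l `\` Gle.
  apply/seteqP; split => -[x y] [/=]; rewrite /=.
    rewrite !(ElevelP _ _ _ _ l0) metric_sym distrC eq_sym => ?.
    by rewrite /Glt /= ltNge => /negP.
  rewrite !(ElevelP _ _ _ _ l0) metric_sym distrC eq_sym => ?.
  by rewrite /Glt /Gle /= ltNge => /negP.
by rewrite swapE addeC -(measureDI (nu \x nu)%E mE mGle).
Qed.

Lemma Elevel_bound (l : R) : 0 < l ->
  ((l `^ p)%:E * (nu \x nu) (Elevel u (s / p) l)
    <= (2 `^ (p + 1) * CA)%:E * I)%E.
Proof.
move=> l0; rewrite Elevel_split// ge0_muleDr//.
have -> : ((2 `^ (p + 1) * CA)%:E * I =
    (2 `^ p * CA)%:E * I + (2 `^ p * CA)%:E * I)%E.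
  have c0 : (0 <= (2 `^ p * CA)%:E)%E.
    by rewrite lee_fin mulr_ge0 ?powR_ge0// ltW.
  rewrite -ge0_muleDl// -EFinD powRD ?powRr1//; last first.
    by rewrite pnatr_eq0 implybT.
  by rewrite mulrAC mulr_natr mulr2n.
apply: leeD.
  apply: product_level_bound => // x y; rewrite /Gle /=; exact: ltW.
apply: product_level_bound => // x y; rewrite /Glt /=; exact: ltW.
Qed.

Lemma Elevel_limit :
  ((l `^ p)%:E * (nu \x nu) (Elevel u (s / p) l))%E @[l --> 0^'+]
    --> ((2 * A)%:E * I)%E.
Proof.
have Ifin : I \is a fin_num.
  rewrite ge0_fin_numE//; apply: integral_ge0 => x _.
  by rewrite lee_fin powR_ge0.
have limle := @product_level_limit d R X nu s p CA A u Gle borelX sepX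
  s0 p0 CA0 A0 ahl avr mu intu mGle (fun x y => @ltW _ _ _ _) (fun x y h => h).
have limlt := @product_level_limit d R X nu s p CA A u Glt borelX sepX
  s0 p0 CA0 A0 ahl avr mu intu mGlt (fun x y h => h) (fun x y => @ltW _ _ _ _).
have -> : ((2 * A)%:E * I = A%:E * I + A%:E * I)%E.
  rewrite -ge0_muleDl ?lee_fin ?(ltW A0)// -EFinD.
  by rewrite mulrC mulr_natr mulr2n.
(* Finiteness makes the sum of the two limits well defined in the extended reals. *)
have AIfin : (A%:E * I)%E \is a fin_num by rewrite fin_numM.
have lim := cvgeD (fin_num_adde_defl _ AIfin) limle limlt.
apply: (cvg_trans _ (lim _)); apply: near_eq_cvg.
near=> l; have l0 : 0 < l by near: l; exact: nbhs_right_gt.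
by rewrite Elevel_split//; apply/esym/ge0_muleDr.
Unshelve. all: by end_near. Qed.

End weak_type.

Theorem theorem3p1 (d : measure_display) (R : realType)
    (X : measurableMetricType d R) (nu : {measure set X -> \bar R})
    (s CA AVR : R) :
  metric_measure_space nu ->
  nu [set: X] = +oo%E ->
  0 < s ->
  0 < CA -> upper_ahlfors nu s CA ->
  has_avr nu s AVR ->
  (forall x : X, {in `]0, +oo[, continuous (fun r : R => nu (ball x r))}) ->
  forall (p : R) (u : X -> R), 1 <= p -> u \in Lfun nu p%:E ->
  [/\ ((2 * AVR)%:E * 'N[nu]_p%:E [EFin \o u] `^ p
         <= weak_Lp_pow (nu \x nu) p (diff_quot u (s / p)))%E,
      (weak_Lp_pow (nu \x nu) p (diff_quot u (s / p))
         <= (2 `^ (p + 1) * CA)%:E * 'N[nu]_p%:E [EFin \o u] `^ p)%E &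
      ((lambda `^ p)%:E * (nu \x nu) (Elevel u (s / p) lambda))%E
        @[lambda --> 0^'+] -->
      ((2 * AVR)%:E * 'N[nu]_p%:E [EFin \o u] `^ p)%E].
Proof.
move=> [sepX borelX _ _] _ s0 CA0 ahl [A0 [x0 avr]] _ p u p1 uLp.
have p0 : 0 < p by rewrite (lt_le_trans ltr01).
have sfin := sigma_finite_bounded_balls borelX x0 ahl.
(* [nu'] has the same underlying set function as [nu], so results for [nu' \x nu'] apply to
   [nu \x nu] by conversion. *)
pose nu' : {sigma_finite_measure set X -> \bar R} := HB.pack_for
  {sigma_finite_measure set X -> \bar R} (Measure.sort nu)
  (isSFinite.Build _ _ _ (Measure.sort nu) (sfinite_measure_sigma_finite sfin))
  (isSigmaFinite.Build _ _ _ (Measure.sort nu) sfin).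
have mu : measurable_fun setT u.
  by have := sub_Lfun_mfun uLp; rewrite inE.
have NE : ('N[nu]_p%:E [EFin \o u] `^ p = \int[nu']_x (`|u x| `^ p)%:E)%E.
  by rewrite powR_Lnorm ?gt_eqF//; apply: eq_integral.
have intu : (\int[nu']_x (`|u x| `^ p)%:E < +oo)%E.
  rewrite -NE poweR_lty//.
  by have := sub_Lfun_finLfun uLp; rewrite inE.
rewrite NE.
have avr' : exists x0 : X,
  (nu' (ball x0 r) * ((r `^ s)^-1)%:E)%E @[r --> +oo] --> AVR%:E by exists x0.
have lim := @Elevel_limit d R X nu' s p CA AVR u borelX sepX
  s0 p0 CA0 A0 ahl avr' mu intu.
split=> //.
(* [Elevel] unfolds to the superlevel set in [weak_Lp_pow], so each value at [l > 0] lies below the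
   supremum, and hence so does the limit. *)
- apply: (cvge_le _ lim); apply: filterS (nbhs_right_gt 0) => l l0.
  by apply: ereal_sup_ubound; exists l.
- apply: ge_ereal_sup => _ [l l0 <-].
  exact: (@Elevel_bound d R X nu' s p CA u).
Qed.
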